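(* Let $\mathcal E=(E_n)_{n\in\omega}$ be a continuous signature and let $\mathcal K$ be a complete quasivariety of completely regular topological $\mathcal E$-algebras. Let $X$ and $Y$ be stratifiable spaces and let $e:X\to Y$ be a closed topological embedding. Let $(F(X),i_X)$ and $(F(Y),i_Y)$ be the free universal algebras of $X$ and $Y$ in the class $\mathcal K$. Then the induced homomorphism $F(e):F(X)\to F(Y)$, i.e. the unique continuous homomorphism with $F(e)\circ i_X=i_Y\circ e$, is a closed topological embedding.
   Context: A continuous signature is a sequence $\mathcal E=(E_n)_{n\in\omega}$ of topological spaces. A topological $\mathcal E$-algebra is a topological space $X$ endowed with a sequence of continuous maps $e_n:E_n\times X^n\to X$, $n\in\omega$ (the algebraic operations of $X$). A subset $A\subset X$ is a subalgebra if $e_n(E_n\times A^n)\subset A$ for all $n\in\omega$ (it carries the subspace topology and the restricted operations). Cartesian products of topological $\mathcal E$-algebras carry the product topology and coordinatewise operations. A homomorphism between topological $\mathcal E$-algebras $(X,(e_n^X))$ and $(Y,(e_n^Y))$ is a map $h:X\to Y$ (not assumed continuous) such that $e_n^Y(c,h(x_1),\dots,h(x_n))=h(e_n^X(c,x_1,\dots,x_n))$ for all $n\in\omega$, $c\in E_n$, $x_1,\dots,x_n\in X$. Two topological $\mathcal E$-algebras are algebraically isomorphic if there is a bijective homomorphism between them. A class $\mathcal K$ of topological $\mathcal E$-algebras is a quasivariety if it is closed under taking subalgebras and arbitrary Cartesian products. A quasivariety $\mathcal K$ is complete if every completely regular topological $\mathcal E$-algebra that is algebraically isomorphic to a member of $\mathcal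 K$ belongs to $\mathcal K$. A free universal algebra of a topological space $X$ in the class $\mathcal K$ is a pair $(F(X),i_X)$ consisting of a topological $\mathcal E$-algebra $F(X)\in\mathcal K$ and a continuous map $i_X:X\to F(X)$ such that for every continuous map $f:X\to K$ into a topological $\mathcal E$-algebra $K\in\mathcal K$ there is a unique continuous homomorphism $h:F(X)\to K$ with $f=h\circ i_X$. If $\mathcal K$ is a quasivariety, it is known that a free universal algebra of every topological space exists and is unique up to topological isomorphism (an algebraic isomorphism that is a homeomorphism). For a continuous map $f:X\to Y$, $F(f):F(X)\to F(Y)$ denotes the unique continuous homomorphism with $F(f)\circ i_X=i_Y\circ f$. A regular topological space $X$ is stratifiable if there is a function $G$ assigning to each $n\in\omega$ and each closed subset $H\subset X$ an open set $G(n,H)\supset H$ such that $H=\bigcap_{n\in\omega}\overline{G(n,H)}$, and $G(n,K)\supset G(n,H)$ for all $n\in\omega$ and all closed sets $K\supset H$. A closed topological embedding is a topological embedding with closed image. Convention: regular and completely regular spaces are assumed to be Hausdorff (so completely regular means Tychonoff). *)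

(* Defs.v *)
From HB Require Import structures.
From mathcomp Require Import all_boot all_order all_algebra.
From mathcomp Require Import all_classical all_reals all_analysis.

Set Implicit Arguments.
Unset Strict Implicit.
Unset Printing Implicit Defensive.

Local Open Scope classical_set_scope.

(* [regular_space] and [completely_regular_space] of the library do not include
   the Hausdorff axiom, hence the explicit conjuncts below. *)
Definition tychonoff_space (T : topologicalType) : Prop :=
  hausdorff_space T /\ completely_regular_space T.

(* The values of [G n] on non-closed sets are irrelevant. *)
Definition stratifiable_space (T : topologicalType) : Prop :=
  [/\ hausdorff_space T, @regular_space T &
      exists G : nat -> set T -> set T,
        [/\ forall n H, closed H -> open (G n H) /\ H `<=` G n H,
            forall H, closed H -> H = \bigcap_n closure (G n H) &
            forall n H L, closed H -> closed L -> H `<=` L ->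
              G n H `<=` G n L]].

(* The third clause says that f is an open map onto its range, the latter
   carrying the subspace topology. *)
Definition topological_embedding (S T : topologicalType) (f : S -> T) : Prop :=
  [/\ injective f, continuous f &
      forall U : set S, open U ->
        open (f @` U : set (subspace (range f)))].

Definition closed_topological_embedding (S T : topologicalType) (f : S -> T) :
    Prop :=
  topological_embedding f /\ closed (range f).

(* X^n is the space of maps 'I_n -> X with the topology of pointwise
   convergence, that is, the product topology; X^0 is a point. *)
Record topAlg (E : nat -> topologicalType) := TopAlg {
  alg_space :> topologicalType;
  alg_op : forall n, E n * {ptws 'I_n -> alg_space} -> alg_space;
  alg_op_continuous : forall n, continuous (@alg_op n) }.

Arguments alg_op {E} t {n} _.
Arguments alg_op_continuous {E} t n.

Definition alg_hom (E : nat -> topologicalType) (A B : topAlg E) (h : A -> B) :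
    Prop :=
  forall n (c : E n) (x : 'I_n -> A),
    alg_op B (c, h \o x) = h (alg_op A (c, x)).

Definition alg_isomorphic (E : nat -> topologicalType) (A B : topAlg E) :
    Prop :=
  exists h : A -> B, alg_hom h /\ bijective h.

Definition subalgebra (E : nat -> topologicalType) (A : topAlg E) (S : set A) :
    Prop :=
  forall n (c : E n) (x : 'I_n -> A),
    (forall i, S (x i)) -> S (alg_op A (c, x)).

Lemma ptws_continuous (T : topologicalType) (I : Type)
    (U : I -> topologicalType) (f : T -> prod_topology U) :
  (forall i, continuous (fun t => f t i)) -> continuous f.
Proof.
move=> fc t; apply/cvg_sup => i V /= [W [[D oD <-] Dfti] WV].
have : nbhs (f t i) D by apply: open_nbhs_nbhs.
move=> /(fc i t); rewrite /= !nbhs_simpl /=.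
by apply: filterS => s /= Ds; apply: WV.
Qed.

Lemma ptws_eval_continuous (I : Type) (U : I -> topologicalType) (i : I) :
  continuous (fun f : prod_topology U => f i).
Proof. exact: (@proj_continuous {classic I} U i). Qed.

Lemma alg_op_comp_continuous (E : nat -> topologicalType) (A : topAlg E) n
    (T : topologicalType) (c : T -> E n) (x : T -> {ptws 'I_n -> A}) :
  continuous c -> (forall i, continuous (fun t => x t i)) ->
  continuous (fun t => alg_op A (c t, x t)).
Proof.
move=> cc cx t; pose g s : E n * {ptws 'I_n -> A} := (c s, x s).
apply: (@continuous_comp _ _ _ g (@alg_op E A n)); last exact: alg_op_continuous.
apply: (@cvg_pair _ _ _ _ (nbhs (c t)) (nbhs (x t : {ptws _ -> _}))).
  exact: cc.
by apply: (@ptws_continuous _ _ (fun=> alg_space A) x) => i; exact: cx.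
Qed.

Lemma arg_continuous n (U V : topologicalType)
    (i : 'I_n) :
  continuous (fun p : U * {ptws 'I_n -> V} => p.2 i).
Proof.
move=> p; apply: (@continuous_comp _ _ _ snd (fun f : {ptws 'I_n -> V} => f i)).
  exact: cvg_snd.
exact: ptws_eval_continuous.
Qed.

Section SubAlgebra.
Variables (E : nat -> topologicalType) (A : topAlg E) (S : set A).
Hypothesis subS : subalgebra S.

Lemma sub_op_subproof n (p : E n * {ptws 'I_n -> S}) :
  alg_op A (p.1, fun i => set_val (p.2 i)) \in S.
Proof.
by apply/mem_set/subS => i; exact: set_valP.
Qed.

Definition sub_op n (p : E n * {ptws 'I_n -> S}) : S :=
  exist _ (alg_op A (p.1, fun i => set_val (p.2 i))) (sub_op_subproof p).

Lemma sub_op_continuous n : continuous (@sub_op n).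
Proof.
apply: continuous_comp_initial.
apply: (@alg_op_comp_continuous _ _ _ _ fst
  (fun p : E n * {ptws 'I_n -> S} => fun i => set_val (p.2 i))) => [p|i p].
  exact: cvg_fst.
apply: (@continuous_comp _ _ _ (fun p : E n * {ptws 'I_n -> S} => p.2 i)).
  exact: arg_continuous.
exact: initial_continuous.
Qed.

Definition sub_topAlg : topAlg E := TopAlg sub_op_continuous.

End SubAlgebra.

Section ProductAlgebra.
Variables (E : nat -> topologicalType) (I : Type) (A : I -> topAlg E).

Definition prod_op n (p : E n * {ptws 'I_n -> prod_topology A}) :
    prod_topology A :=
  fun j => alg_op (A j) (p.1, fun i => p.2 i j).

Lemma prod_op_continuous n : continuous (@prod_op n).
Proof.
apply: ptws_continuous => j.
apply: (@alg_op_comp_continuous _ _ _ _ fst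
  (fun p : E n * {ptws 'I_n -> prod_topology A} => fun i => p.2 i j)) => [p|i p].
  exact: cvg_fst.
apply: (@continuous_comp _ _ _
  (fun p : E n * {ptws 'I_n -> prod_topology A} => p.2 i)
  (fun f : prod_topology A => f j)).
  exact: arg_continuous.
exact: ptws_eval_continuous.
Qed.

Definition prod_topAlg : topAlg E := TopAlg prod_op_continuous.

End ProductAlgebra.

Definition quasivariety (E : nat -> topologicalType) (K : topAlg E -> Prop) :
    Prop :=
  (forall (A : topAlg E) (S : set A) (subS : subalgebra S),
     K A -> K (sub_topAlg subS)) /\
  (forall (I : Type) (A : I -> topAlg E),
     (forall i, K (A i)) -> K (prod_topAlg A)).

Definition complete_quasivariety (E : nat -> topologicalType)
    (K : topAlg E -> Prop) : Prop :=
  quasivariety K /\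
  forall A B : topAlg E,
    tychonoff_space A -> K B -> alg_isomorphic A B -> K A.

Definition free_algebra (E : nat -> topologicalType) (K : topAlg E -> Prop)
    (X : topologicalType) (F : topAlg E) (i : X -> F) : Prop :=
  [/\ K F, continuous i &
      forall (A : topAlg E) (f : X -> A), K A -> continuous f ->
        exists! h : F -> A, [/\ continuous h, alg_hom h & f = h \o i]].

(* [h] satisfies the conditions that characterize F(f). *)
Definition induced_hom (E : nat -> topologicalType) (X Y : topologicalType)
    (f : X -> Y) (FX FY : topAlg E) (iX : X -> FX) (iY : Y -> FY)
    (h : FX -> FY) : Prop :=
  [/\ continuous h, alg_hom h & h \o iX = iY \o f].

(* Main.v *)
Require Import Defs.
From HB Require Import structures.
From mathcomp Require Import all_boot all_order all_algebra.
From mathcomp Require Import all_classical all_reals all_analysis.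
From mathcomp Require Import Rstruct lra.
From mathcomp Require wochoice.

(** The idea is to extend the unit [iX] of [FX] from [X] to [Y] inside a larger
    algebra of the class. Let [A := FX] and let [hm A] be the algebra of step
    functions [f : [0, 1) -> A], two of them being close when they are close
    outside a set of small measure (the Hartman-Mycielski construction). As an
    algebra, [hm A] is a subalgebra of a power of [A]; its topology comes from
    a Hausdorff uniformity that makes the operations continuous
    ([hm_op_continuous], [hm_hausdorff]). So the completeness of the class puts
    [hm A] into it ([hm_alg_in_class]), and the constant functions embed [A]
    into [hm A] as a closed subalgebra ([hm_const_embedding],
    [hm_const_closed]).

    Step functions play the part of convex combinations in the Dugundji
    extension theorem: a point of [hm A] is a list of values in [A] with
    weights of total 1. Hence [iX], viewed as a map into the constant
    functions, extends along [e] to a continuous map [g : Y -> hm A]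
    ([extension]). By the universal property of [FY], [g] induces a continuous
    homomorphism [ghat : FY -> hm A], and the uniqueness part of the universal
    property of [FX] gives [ghat \o F(e) = hm_const]. As this composite is a
    closed embedding, so is its first factor ([closed_embedding_factor]).

    The extension follows Borges. A stratification of [Y] provides each pair of
    a point [x] and an open set [U] around it with a neighbourhood [cell n U
    x], in such a way that when two cells intersect, the one of lower level [n]
    has the centre of the other in its set [U] ([cell_meet]). Let [Z] be the
    complement of the closed range of [e]. The cells in [Z] cover it, and every
    [y] in [Z] is assigned a value [v y] of [iX]; near a point [e x] only cells
    whose values [v y] are close to [iX x] occur ([anchor_exists],
    [anchor_nbhs]). These values are combined by countably many weight
    functions [w_n] on [Y]. The cover of [Z] has a refinement made of countably
    many discrete families of closed sets ([sigma_discrete_refinement]); by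
    collectionwise normality the [n]-th one expands to a disjoint family of
    open sets, [w_n] is supported in its union, and each point of [Z] satisfies
    [w_n z = 1] for some [n]. The products [tail n z] of the [1 - w_i z], [i <=
    n], decrease and reach 0 at some finite [n], thus cut [0, 1) into finitely
    many intervals, and disjointness singles out one value for each of them.
    The number of steps need not be locally bounded, but finitely many steps
    exhaust the interval at a given point and vary continuously with it, so at
    nearby points the remaining steps occupy a small part of the interval. *)

Set Implicit Arguments.
Unset Strict Implicit.
Unset Printing Implicit Defensive.

Import Order.TTheory GRing.Theory Num.Theory.
Import numFieldNormedType.Exports.

Local Open Scope classical_set_scope.

(** * Embeddings *)

Lemma embedding_nbhs (S T : topologicalType) (c : S -> T) (x : S) (W : set S) :
  topological_embedding c -> nbhs x W ->
  exists V, [/\ open V, V (c x) & forall y, V (c y) -> W y].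
Proof.
move=> [inj_c _ c_open]; rewrite nbhsE => -[U [oU Ux UW]].
have [V oV VU] := (@open_subspaceP T (range c) (c @` U)).1 (c_open _ oU).
have VUP y : V (c y) <-> U y.
  split=> [Vy|Uy].
    have : (V `&` range c) (c y) by split => //; exists y.
    by rewrite VU => -[[u Uu /inj_c <-]].
  have : (c @` U `&` range c) (c y) by split; exists y.
  by rewrite -VU => -[].
by exists V; split => [//||y /VUP/UW //]; exact/VUP.
Qed.

Lemma nbhs_embedding (S T : topologicalType) (c : S -> T) :
  injective c -> continuous c ->
  (forall x W, nbhs x W ->
     exists2 N, nbhs (c x) N & forall y, N (c y) -> W y) ->
  topological_embedding c.
Proof.
move=> inj_c cont_c c_nbhs; split => // U oU.
apply/(@open_subspaceP T (range c) (c @` U)).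
exists (\bigcup_(N in [set N | open N /\ forall y, N (c y) -> U y]) N).
  by apply: bigcup_open => N [].
apply/seteqP; split=> t [tV [x _ xt]]; subst t; split; try by exists x.
  by case: tV => N [_ NU] /NU Ux; exists x.
have Ux : U x by case: tV => u Uu /inj_c <-.
have [N + NU] := c_nbhs x U (open_nbhs_nbhs (conj oU Ux)).
by rewrite nbhsE => -[V [oV Vx VN]]; exists V => //; split=> // y /VN/NU.
Qed.

(** A limit of points [h x] is mapped by [g] into the closed range of the
    composite, hence to some [g (h x)]; since the composite is an embedding,
    the points converge, and their images have only one limit. *)
Lemma closed_embedding_factor (A B C : topologicalType) (h : A -> B)
    (g : B -> C) : hausdorff_space B -> continuous h -> continuous g ->
  closed_topological_embedding (g \o h) -> closed_topological_embedding h.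
Proof.
move=> B_hausdorff cont_h cont_g [gh_emb gh_closed]; split.
  apply: nbhs_embedding => //.
    by have [gh_inj _ _] := gh_emb; apply: inj_compr gh_inj.
  move=> x W /(embedding_nbhs gh_emb)[V [oV Vx VW]]; exists (g @^-1` V) => //.
  by apply: cont_g; exact: open_nbhs_nbhs.
move=> y cy; have : closure (range (g \o h)) (g y).
  move=> P /cont_g/cy[_ [[x _ <-] Px]]; exists (g (h x)).
  by split => //; exists x.
move=> /gh_closed[x _ ghx]; exists x => //; apply: B_hausdorff => P Q hxP yQ.
have [V [oV Vx VP]] := embedding_nbhs gh_emb (cont_h _ _ hxP).
have yV : nbhs y (g @^-1` V).
  by apply: cont_g; apply: open_nbhs_nbhs; rewrite -ghx.
by have [_ [[z _ <-] [Qz /VP Pz]]] := cy _ (filterI yQ yV); exists (h z).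
Qed.

(** * Stratifications of open sets *)

(** The stratification of closed sets, read on their complements and with
    levels made increasing. *)
Definition open_stratification (Y : topologicalType)
    (S : nat -> set Y -> set Y) : Prop :=
  [/\ forall n U, open U -> open (S n U),
      forall n U, open U -> closure (S n U) `<=` U,
      forall U, open U -> U `<=` \bigcup_n S n U,
      forall n U V, open U -> open V -> U `<=` V -> S n U `<=` S n V &
      forall m n U, open U -> (m <= n)%N -> S m U `<=` S n U].

Lemma stratifiable_open_stratification (Y : topologicalType) :
  stratifiable_space Y ->
  exists S : nat -> set Y -> set Y, open_stratification S.
Proof.
move=> [_ _ [G [Gopen Gcap Gmono]]].
(* Intersecting the first levels makes the levels decrease. *)
pose G' := fix G' n H := if n is m.+1 then G' m H `&` G n H else G 0 H.
have G'open n H : closed H -> open (G' n H).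
  move=> cH; elim: n => [|n IH]; first exact: (Gopen _ _ cH).1.
  by apply: openI => //; exact: (Gopen _ _ cH).1.
have G'sub n H : closed H -> H `<=` G' n H.
  move=> cH; elim: n => [|n IH]; first exact: (Gopen _ _ cH).2.
  by move=> x Hx; split; [exact: IH | exact: (Gopen _ _ cH).2].
have G'G n H : G' n H `<=` G n H by case: n => //= n x [].
have G'S n m H : G' (n + m)%N H `<=` G' n H.
  by elim: m => [|m IH]; rewrite ?addn0 // addnS => x [/IH].
exists (fun n U => ~` closure (G' n (~` U))); split.
- by move=> n U oU; rewrite openC; exact: closed_closure.
- move=> n U oU; have cU := open_closedC oU.
  apply: (@subset_trans _ (~` G' n (~` U))).
    have /closure_id -> : closed (~` G' n (~` U)).
      exact/open_closedC/G'open.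
    by apply: closureS; apply: subsetC; exact: subset_closure.
  by rewrite -[X in _ `<=` X]setCK; apply: subsetC; exact: G'sub.
- move=> U oU x Ux; have cU := open_closedC oU.
  apply: contrapT => nx; have : (~` U) x; last by apply.
  rewrite (Gcap _ cU) => n _; apply: contrapT => nGx; apply: nx.
  by exists n => // /(closureS (@G'G n (~` U))).
- move=> n U V oU oV UV; apply: subsetC; apply: closureS.
  have := subsetC UV; move: (open_closedC oU) (open_closedC oV) => cU cV VU.
  elim: n => [|n IH] /=; first exact: Gmono.
  by move=> x [/IH ? ?]; split => //; apply: Gmono VU _ _.
- move=> m n U oU mn; apply: subsetC; apply: closureS.
  by rewrite -(subnKC mn); exact: G'S.
Qed.

(** For [x] in [S n U] this is the neighbourhood of [x] in [U] that Borges uses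
    to show that a stratifiable space is monotonically normal. *)
Definition cell (Y : topologicalType) (S : nat -> set Y -> set Y) n
    (U : set Y) (x : Y) : set Y :=
  S n U `&` ~` closure (S n (~` [set x])).

Section Cells.
Variables (R : realType) (Y : topologicalType).
Hypothesis Y_hausdorff : hausdorff_space Y.
Variable S : nat -> set Y -> set Y.
Hypothesis S_strat : open_stratification S.

Local Notation cell := (cell S).

Lemma open_setC1 (x : Y) : open (~` [set x]).
Proof. by apply/closed_openC/accessible_closed_set1/hausdorff_accessible. Qed.

Lemma open_cell n U x : open U -> open (cell n U x).
Proof.
case: S_strat => So _ _ _ _ oU; apply: openI; first exact: So.
by rewrite openC; exact: closed_closure.
Qed.

Lemma cell_sub n U x : open U -> cell n U x `<=` U.
Proof.
case: S_strat => _ Sc _ _ _ oU y [SUy _].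
by apply: (Sc n U oU); exact: subset_closure.
Qed.

Lemma cell_center n U x : S n U x -> cell n U x x.
Proof.
by case: S_strat => _ Sc _ _ _ SUx; split => // /(Sc _ _ (open_setC1 x))/=.
Qed.

Lemma cell_exists U x : open U -> U x -> exists n, S n U x.
Proof. by case: S_strat => _ _ Su _ _ oU /(Su _ oU)[n _]; exists n. Qed.

(** If [y] were outside [U], the [n]-th level of [U] would lie in the [m]-th
    level of the complement of [y], from which the second cell keeps away. *)
Lemma cell_meet n m U V x y z : open U -> (n <= m)%N ->
  cell n U x z -> cell m V y z -> U y.
Proof.
case: S_strat => _ _ _ Sm Sn oU nm [SUz _] [_ nSz]; apply: contrapT => nUy.
apply: nSz; apply: subset_closure; apply: (Sn n) => //.
  exact: open_setC1.
apply: Sm SUz => //; first exact: open_setC1.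
by move=> w /= Uw wy; apply: nUy; rewrite -wy.
Qed.

Lemma cells_meet n m U V x y z : open U -> open V ->
  cell n U x z -> cell m V y z -> U y \/ V x.
Proof.
move=> oU oV cU cV; have [nm|/ltnW mn] := leqP n m.
  by left; exact: cell_meet cU cV.
by right; exact: cell_meet cV cU.
Qed.

(** Collectionwise normality. A point of [D i] gets a cell inside a set [G i]
    that avoids all the other [D j]. If two cells for [i <> j] met, the centre
    of one would lie in [G] of the other. *)
Lemma discrete_expansion (I : Type) (D U : I -> set Y) :
  (forall i, open (U i)) -> (forall i, D i `<=` U i) ->
  (forall i z, D i z -> exists2 N, nbhs z N &
     forall j w, N w -> D j w -> j = i) ->
  exists O : I -> set Y,
    [/\ forall i, open (O i), forall i, D i `<=` O i, forall i, O i `<=` U i &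
        forall i j z, O i z -> O j z -> i = j].
Proof.
move=> oU DU Ddisc.
pose G i := U i `&` ~` closure (\bigcup_(j in [set j | j <> i]) D j).
have oG i : open (G i).
  by apply: openI => //; rewrite openC; exact: closed_closure.
have DG i : D i `<=` G i.
  move=> z Dz; split; first exact: DU.
  have [N Nz ND] := Ddisc _ _ Dz.
  by move=> /(_ _ Nz)[w [[j /= ji Djw] /(ND _ _)/(_ Djw)]].
exists (fun i => \bigcup_(p in [set p | D i p.2 /\ S p.1 (G i) p.2])
          cell p.1 (G i) p.2); split.
- by move=> i; apply: bigcup_open => p _; exact: open_cell.
- move=> i z Dz; have [n Sn] := cell_exists (oG i) (DG _ _ Dz).
  by exists (n, z) => //; exact: cell_center.
- by move=> i z [p _ /(cell_sub (oG i))[]].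
- move=> i j z [[n x] /= [Dx _] xz] [[m y] /= [Dy _] yz].
  apply: contrapT => ij; case: (cells_meet (oG i) (oG j) xz yz).
    by move=> [_]; apply; apply: subset_closure; exists j => //= ji; apply: ij.
  by move=> [_]; apply; apply: subset_closure; exists i.
Qed.

Lemma cells_normal : normal_space Y.
Proof.
apply/(@normal_openP R) => A B cA cB AB0.
pose D (b : bool) := if b then A else B.
have [||i z Dz|O [oO DO _ Odisj]] := @discrete_expansion bool D (fun=> setT).
- by move=> _; exact: openT.
- by [].
- exists (~` D (~~ i)); last first.
    by case: i {Dz} => -[] w nD Dj //; case: nD.
  apply: open_nbhs_nbhs; split; first by apply: closed_openC; case: i {Dz}.
  by move=> Dz'; have : (A `&` B) z; [case: i Dz Dz' | rewrite AB0].
exists (O true), (O false); split => //; first exact: (DO true).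
  exact: (DO false).
by rewrite -subset0 => z [/Odisj h /h].
Qed.

End Cells.

(** * Weights subordinate to an open cover *)

Section Refinement.
Variables (R : realType) (Y : topologicalType).
Hypothesis Y_hausdorff : hausdorff_space Y.
Variable S : nat -> set Y -> set Y.
Hypothesis S_strat : open_stratification S.

(** Well-order the index set and sort the points of the union by the first
    [U i] that contains them. The [n]-th family retains the points whose first
    index is [i] and which lie in the closure of the [n]-th level of the union
    [Vle i] of the [U j] with [j <= i]. Monotonicity of the stratification in
    the open set is what makes it discrete: all the earlier members lie in the
    closure of the [n]-th level of [Vlt i], and this closure stays inside
    [Vlt i]. *)
Lemma sigma_discrete_refinement (I : Type) (U : I -> set Y) :
  (forall i, open (U i)) ->
  exists D : nat -> I -> set Y,
    [/\ forall n i, D n i `<=` U i,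
        forall n i z, D n i z -> exists2 N, nbhs z N &
          forall j w, N w -> D n j w -> j = i,
        forall n, closed (\bigcup_i D n i) &
        forall i z, U i z -> exists n j, D n j z].
Proof.
move=> oU; case: S_strat => So Sc Su Sm Sn.
have [le le_wo] := wochoice.well_ordering_principle {classic I}.
have [le_trans le_anti le_total] :
    [/\ transitive le, antisymmetric le & total le].
  have wo : wochoice.wo_chain le predT by exact: wochoice.withinW.
  have anti : antisymmetric le.
    by move=> x y; exact: (wochoice.wo_chain_antisymmetric wo).
  have tot : total le by move=> x y; exact: (wochoice.wo_chainW wo).
  split => // y x z xy yz.
  have [|m [[+ mlow] _]] := le_wo (pred3 x y z).
    by exists x; rewrite !inE eqxx.
  have := mlow x; have := mlow y; have := mlow z; rewrite !inE !eqxx !orbT.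
  move=> /(_ isT) mz /(_ isT) my /(_ isT) mx /or3P[] /eqP mE; subst m => //.
    by rewrite (_ : x = y) //; apply: anti; rewrite xy.
  by rewrite (_ : y = z) in xy *; [|apply: anti; rewrite yz].
pose first z i := U i z /\ forall j, U j z -> le i j.
have firstP i z : U i z -> exists j, first z j.
  move=> Uz; have [|j [[+ jlow] _]] :=
    le_wo (fun j : {classic I} => `[< U j z >]).
    by exists i; apply/asboolP.
  move=> /asboolP Ujz; exists j; split => // k Ukz; apply: jlow.
  exact/asboolP.
pose Vle i := \bigcup_(j in [set j : I | le j i]) U j.
pose Vlt i := \bigcup_(j in [set j : I | le j i /\ j <> i]) U j.
have le_refl i : le i i by case/orP: (le_total i i).
have oVle i : open (Vle i) by apply: bigcup_open => j _; exact: oU.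
have oVlt i : open (Vlt i) by apply: bigcup_open => j _; exact: oU.
have first_nlt z i : first z i -> ~ Vlt i z.
  by move=> [_ fi] [j [ji nij] /fi ij]; apply: nij; apply: le_anti; rewrite ji.
have firstVle z i : first z i -> Vle i z.
  by move=> [Uz _]; exists i => //=; exact: le_refl.
pose D n i := [set z | first z i /\ closure (S n (Vle i)) z].
(* The part of [Vle i] away from the [n]-th level of [Vlt i] meets no member
   of the [n]-th family but the [i]-th one. *)
pose N n i := Vle i `&` ~` closure (S n (Vlt i)).
have NP n i z : first z i -> nbhs z (N n i).
  move=> fz; apply: open_nbhs_nbhs; split.
    by apply: openI => //; rewrite openC; exact: closed_closure.
  by split; [exact: firstVle | move=> /(Sc _ _ (oVlt i)); exact: first_nlt].
have ND n i j w : N n i w -> D n j w -> j = i.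
  move=> [[k /= ki Uk] nw] [[Uj fj] cw]; apply: contrapT => ji.
  have /orP[ij|jlei] := le_total i j.
    by apply: ji; apply: le_anti; rewrite ij (le_trans _ _ _ (fj _ Uk) ki).
  apply: nw; apply: closureS cw; apply: (Sm _ _ _ (oVle j) (oVlt i)).
  move=> u [l /= lj Ul]; exists l => //; split; first exact: le_trans lj jlei.
  by move=> li; subst l; apply: ji; apply: le_anti; rewrite jlei.
exists D; split.
- by move=> n i z [[]].
- move=> n i z [fz _]; exists (N n i); first exact: NP.
  by move=> j w; exact: ND.
- move=> n z cz.
  have [i fi] : exists i, first z i.
    have oT : open (\bigcup_i U i) by exact: bigcup_open.
    have [|i _ /firstP//] := Sc n _ oT z.
    apply: closed_closure; apply: closureS cz => w [i _ [_]].
    by apply: closureS; apply: Sm => // u [j _ Uj]; exists j.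
  exists i => //; split => //; apply: contrapT => nz.
  have : nbhs z (N n i `&` ~` closure (S n (Vle i))).
    apply: filterI; first exact: NP.
    by apply: open_nbhs_nbhs; split => //; rewrite openC; exact: closed_closure.
  move=> /cz[w [[j _ Dw] [Nw nw]]].
  by have ji := ND _ _ _ _ Nw Dw; subst j; case: Dw.
- move=> i z /firstP[j fz].
  have [n _ Sz] := Su _ (oVle j) z (firstVle _ _ fz).
  by exists n, j; split => //; exact: subset_closure.
Qed.

(** A substitute for a subordinate partition of unity: since [piece n] is a
    disjoint family, a nonzero weight [weight n z] belongs to a single index,
    and a weight equal to 1 leaves no part of the unit interval to the later
    ones. *)
Record weighted_refinement (I : Type) (U : I -> set Y) := WeightedRefinement {
  piece : nat -> I -> set Y;
  weight : nat -> Y -> R;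
  open_piece : forall n i, open (piece n i);
  piece_sub : forall n i, piece n i `<=` U i;
  piece_disjoint : forall n i j z, piece n i z -> piece n j z -> i = j;
  weight_continuous : forall n, continuous (weight n);
  weight_itv : forall n z, (0 <= weight n z <= 1)%R;
  weight_piece : forall n z, weight n z <> 0%R -> exists i, piece n i z;
  weight_eq1 : forall i z, U i z -> exists n, weight n z = 1%R }.

Lemma weighted_refinement_exists (I : Type) (U : I -> set Y) :
  (forall i, open (U i)) -> inhabited (weighted_refinement U).
Proof.
move=> oU; have [D [DU Ddisc Dclosed Dcover]] := sigma_discrete_refinement oU.
have /choice[P Pprop] := (fun n =>
  discrete_expansion Y_hausdorff S_strat oU (DU n) (Ddisc n)).
have /choice[f fprop] : forall n, exists f : Y -> R, [/\ continuous f,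
    range f `<=` [set` `[0, 1]%R], f @` (~` \bigcup_i P n i) `<=` [set 0%R] &
    f @` (\bigcup_i D n i) `<=` [set 1%R]].
  move=> n; have [oO DO _ _] := Pprop n.
  apply/uniform_separatorP.
  apply: ((@normal_separatorP R Y).1 (cells_normal R Y_hausdorff S_strat)).
  - by rewrite closedC; exact: bigcup_open.
  - exact: Dclosed.
  - rewrite -subset0 => z [nz [i _ Dz]]; apply: nz; exists i => //; exact: DO.
constructor; apply: (@WeightedRefinement I U P f).
- by move=> n; have [] := Pprop n.
- by move=> n; have [] := Pprop n.
- by move=> n; have [] := Pprop n.
- by move=> n; have [] := fprop n.
- move=> n z; have [_ /(_ (f n z)) + _ _] := fprop n.
  by rewrite /= in_itv /=; apply; exists z.
- move=> n z nz; apply: contrapT => nO; apply: nz.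
  have [_ _ + _] := fprop n; apply; exists z => //.
  by move=> [i _ Pz]; apply: nO; exists i.
- move=> i z /Dcover[n [j Dz]]; exists n.
  by have [_ _ _] := fprop n; apply; exists z => //; exists j.
Qed.

End Refinement.

(** * Small subsets of the half-open unit interval *)

Section SmallSets.
Variable R : realType.

Definition half_open_itv : Type := {t : R | (0 <= t < 1)%R}.

(** An outer measure is monotone and subadditive on arbitrary sets, which is
    all that the uniformity on step functions relies on. *)
Definition small (r : R) (A : set half_open_itv) : Prop :=
  ((wlength idfun)^* (sval @` A) < r%:E)%mu%E.

Lemma small_sub r A B : A `<=` B -> small r B -> small r A.
Proof.
by move=> AB; apply: le_lt_trans; apply: le_outer_measure; exact: image_subset.
Qed.

Lemma small_le r s A : (r <= s)%R -> small r A -> small s A.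
Proof. by move=> rs /lt_le_trans; apply; rewrite lee_fin. Qed.

Lemma smallU r s A B : small r A -> small s B -> small (r + s) (A `|` B).
Proof.
move=> rA sB; rewrite /small image_setU EFinD.
by apply: le_lt_trans (lteD rA sB); exact: outer_measureU2.
Qed.

Lemma small_set0 r : (0 < r)%R -> small r set0.
Proof. by move=> r0; rewrite /small image_set0 outer_measure0 lte_fin. Qed.

Lemma small_union (I : eqType) (s : seq I) (A : I -> set half_open_itv) r :
  (0 < r)%R -> (forall i, small r (A i)) ->
  small (r *+ (size s).+1) [set t | exists2 i, i \in s & A i t].
Proof.
move=> r0 rA; elim: s => [|i s IH].
  by apply: small_sub (small_set0 r0) => t [].
rewrite mulrS; apply: small_sub (smallU (rA i) IH) => t [j].
by rewrite inE => /predU1P[-> ?|js ?]; [left | right; exists j].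
Qed.

Lemma small_finite_union (I : finType) r : (0 < r)%R ->
  exists2 d : R, (0 < d)%R & forall A : I -> set half_open_itv,
    (forall i, small d (A i)) -> small r [set t | exists i, A i t].
Proof.
move=> r0; exists (r / (size (enum I)).+1%:R)%R; first by rewrite divr_gt0.
move=> A sA; have := small_union (enum I) _ sA.
rewrite -(mulr_natr (r / _)) divfK ?pnatr_eq0 // divr_gt0 // => /(_ isT).
by apply: small_sub => t [i Ait]; exists i => //; rewrite mem_enum.
Qed.

Lemma small_segment (a r : R) : (0 < r)%R ->
  exists2 d : R, (0 < d)%R & small r [set t | `|sval t - a| <= d]%R.
Proof.
move=> r0; exists (r / 4)%R; first by rewrite divr_gt0.
apply: (@le_lt_trans _ _ (lebesgue_measure [set` `[a - r / 4, a + r / 4]%R])).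
  apply: le_outer_measure => _ [t /= + <-].
  by rewrite in_itv /= ler_distl.
rewrite lebesgue_measure_itv /=; case: ifP => _; last by rewrite lte_fin.
by rewrite -EFinB lte_fin; lra.
Qed.

(** Step functions that differ at [t] differ on an interval that starts at [t],
    and this separates them in measure. *)
Lemma small_escape (t : half_open_itv) (d : R) : (0 < d)%R ->
  exists2 r : R, (0 < r)%R & forall A, small r A ->
    exists2 u, (sval t <= sval u < sval t + d)%R & ~ A u.
Proof.
move=> d0; case: t => t /= /andP[t0 t1].
pose b := Num.min (t + d)%R 1%R.
have tb : (t < b)%R by rewrite lt_min t1 ltrDl d0.
exists (b - t)%R; first by rewrite subr_gt0.
move=> A sA; apply: contrapT => nA.
suff : (lebesgue_measure [set` `[t, b[%R] < (b - t)%:E)%E.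
  by rewrite lebesgue_measure_itv /= lte_fin tb -EFinB ltxx.
apply: le_lt_trans sA; apply: le_outer_measure => u /=.
rewrite in_itv /= => /andP[tu]; rewrite lt_min => /andP[utd u1].
have uJ : (0 <= u < 1)%R by rewrite u1 (le_trans t0 tu).
exists (exist _ u uJ) => //; apply: contrapT => nAu; apply: nA.
by exists (exist _ u uJ) => //=; rewrite tu.
Qed.

End SmallSets.

(** * The space of step functions *)

(** The two conditions are separate so that each is visibly stable under
    pointwise operations: finitely many values, and local constancy to the
    right. The latter makes functions that agree up to a null set equal. *)
Definition step_fun (R : realType) (A : Type) (f : half_open_itv R -> A) :
    Prop :=
  (exists (D : finType) (p : half_open_itv R -> D),
     forall s t, p s = p t -> f s = f t) /\
  forall t, exists2 d : R, (0 < d)%R &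
    forall u, (sval t <= sval u < sval t + d)%R -> f u = f t.

(** The Hartman-Mycielski space of [A]. *)
Definition hm (R : realType) (A : uniformType) : Type :=
  {f : half_open_itv R -> A | step_fun f}.

Section HartmanMycielski.
Variables (R : realType) (A : uniformType).
Local Notation hm := (hm R A).
Local Open Scope relation_scope.

HB.instance Definition _ := gen_eqMixin hm.
HB.instance Definition _ := gen_choiceMixin hm.

Lemma hm_ext (f g : hm) : (forall t, sval f t = sval g t) -> f = g.
Proof.
case: f g => [f sf] [g sg] /= /funext fg; subst g.
by congr exist; exact: Prop_irrelevance.
Qed.

Definition apart (E : set (A * A)) (f g : hm) : set (half_open_itv R) :=
  [set t | ~ E (sval f t, sval g t)].

(** The uniformity of convergence in measure. *)
Definition hm_ent : set_system (hm * hm) :=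
  [set V | exists E (r : R), [/\ entourage E, (0 < r)%R &
     forall f g, small r (apart E f g) -> V (f, g)]].

Lemma hm_ent_filter : Filter hm_ent.
Proof.
split.
- by exists setT, 1%R; split => //; exact: filterT.
- move=> V W [E [r [eE r0 EV]]] [F [s [eF s0 FW]]].
  exists (E `&` F), (Num.min r s); split; first exact: filterI.
    by rewrite lt_min r0.
  move=> f g sEF; split; [apply: EV | apply: FW].
    apply: small_le (small_sub _ sEF); first by rewrite ge_min lexx.
    by move=> t nE [].
  apply: small_le (small_sub _ sEF); first by rewrite ge_min lexx orbT.
  by move=> t nE [].
- move=> V W VW [E [r [eE r0 EV]]]; exists E, r; split => // f g /EV.
  exact: VW.
Qed.

Lemma hm_ent_diagonal V : hm_ent V -> diagonal `<=` V.
Proof.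
move=> [E [r [eE r0 EV]]] [f g] fg; have -> : f = g by exact: fg.
apply: EV.
by apply: small_sub (small_set0 r0) => t; apply; exact: entourage_refl.
Qed.

Lemma hm_ent_inv V : hm_ent V -> hm_ent V^-1.
Proof.
move=> [E [r [eE r0 EV]]]; exists E^-1, r; split => //.
by move=> f g sE; exact: EV.
Qed.

Lemma hm_ent_split V : hm_ent V -> exists2 W, hm_ent W & W \; W `<=` V.
Proof.
move=> [E [r [eE r0 EV]]].
have r20 : (0 < r / 2)%R by rewrite divr_gt0.
exists [set fg | small (r / 2) (apart (split_ent E) fg.1 fg.2)].
  by exists (split_ent E), (r / 2)%R; split.
move=> [f h] [g /= fg gh]; apply: EV; rewrite [r]splitr.
apply: small_sub (smallU fg gh) => t nE; apply: contrapT => n2; apply: nE.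
by apply: (@entourage_split _ (sval g t)) => //; apply: contrapT => n1;
  apply: n2; [left | right].
Qed.

HB.instance Definition _ := isUniform.Build hm
  hm_ent_filter hm_ent_diagonal hm_ent_inv hm_ent_split.

Lemma hm_nbhs (f : hm) E r : entourage E -> (0 < r)%R ->
  \forall g \near f, small r (apart E f g).
Proof.
move=> eE r0.
have eV : entourage [set fg : hm * hm | small r (apart E fg.1 fg.2)].
  by exists E, r; split.
by apply: filterS (nbhs_entourage f eV) => g /xsectionP.
Qed.

Lemma hm_cvg (F : set_system hm) (f : hm) : Filter F ->
  (forall E r, entourage E -> (0 < r)%R ->
    \forall g \near F, small r (apart E f g)) ->
  F --> f.
Proof.
move=> FF Ff; apply/cvg_entourageP => V [E [r [eE r0 EV]]].
by apply: filterS (Ff _ _ eE r0) => g; exact: EV.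
Qed.

Lemma const_step_fun (a : A) : step_fun (fun _ : half_open_itv R => a).
Proof.
split; last by exists 1%R.
by exists unit, (fun=> tt).
Qed.

Definition hm_const (a : A) : hm := exist _ _ (const_step_fun a).

Lemma hm_const_continuous : continuous hm_const.
Proof.
move=> a; apply: hm_cvg => E r eE r0.
apply: filterS (nbhs_entourage a eE) => b /xsectionP Eab.
by apply: small_sub (small_set0 r0) => t.
Qed.

Hypothesis A_hausdorff : hausdorff_space A.

Lemma entourage_separate (a b : A) : a <> b ->
  exists2 E, entourage E & forall c, E (a, c) -> E (b, c) -> False.
Proof.
move=> ab; apply: contrapT => nE; apply: ab; apply: A_hausdorff.
move=> P Q; rewrite -!nbhs_entourageE => -[E eE EP] [F eF FQ].
apply: contrapT => nPQ; apply: nE; exists (E `&` F); first exact: filterI.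
move=> c [Ec _] [_ Fc]; apply: nPQ; exists c.
by split; [apply: EP | apply: FQ]; exact/xsectionP.
Qed.

Lemma hm_hausdorff : hausdorff_space hm.
Proof.
move=> f g fg; apply: hm_ext => t; apply: contrapT => ftg.
have [E eE Esep] := entourage_separate ftg.
have [_ /(_ t)[d d0 fd]] := svalP f; have [_ /(_ t)[e e0 ge]] := svalP g.
have de0 : (0 < Num.min d e)%R by rewrite lt_min d0.
have [r r0 rP] := @small_escape R t _ de0.
have r20 : (0 < r / 2)%R by rewrite divr_gt0.
have [h [fh gh]] := fg _ _ (hm_nbhs f eE r20) (hm_nbhs g eE r20).
have := smallU fh gh; rewrite -splitr => /rP[u /andP[tu utd]].
move: utd; rewrite -ltrBlDl lt_min => /andP[ud ue]; apply.
apply: contrapT => nu; apply: (Esep (sval h u)).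
  rewrite -(fd u); last by rewrite tu -ltrBlDl.
  by apply: contrapT => n1; apply: nu; left.
rewrite -(ge u); last by rewrite tu -ltrBlDl.
by apply: contrapT => n1; apply: nu; right.
Qed.

Lemma hm_const_embedding : topological_embedding hm_const.
Proof.
have t0 : (0 <= (0 : R) < 1)%R by rewrite lexx ltr01.
pose z : half_open_itv R := exist _ 0%R t0; apply: nbhs_embedding.
- by move=> a b /(congr1 (fun g : hm => sval g z)).
- exact: hm_const_continuous.
move=> a P; rewrite -nbhs_entourageE => -[E eE EP].
have [r r0 rP] := @small_escape R z 1%R ltr01.
exists [set g | small r (apart E (hm_const a) g)]; first exact: hm_nbhs.
move=> b /= /rP[u _ nu]; apply: EP; apply/xsectionP.
by apply: contrapT => nE; exact: nu.
Qed.

(** A limit [f] of constants takes a single value: if [f z <> f t], a constant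
    close to [f] would be close to both values, as [f] keeps each of them on
    an interval. *)
Lemma hm_const_closed : closed (range hm_const).
Proof.
move=> f cf; have t0 : (0 <= (0 : R) < 1)%R by rewrite lexx ltr01.
pose z : half_open_itv R := exist _ 0%R t0.
exists (sval f z) => //; apply: hm_ext => t /=.
apply: contrapT => ftz; have [E eE Esep] := entourage_separate ftz.
have [_ /(_ z)[d d0 fd]] := svalP f; have [_ /(_ t)[e e0 fe]] := svalP f.
have [r r0 rP] := @small_escape R z _ d0.
have [s s0 sP] := @small_escape R t _ e0.
have m0 : (0 < Num.min r s)%R by rewrite lt_min r0.
have mr : (Num.min r s <= r)%R by rewrite ge_min lexx.
have ms : (Num.min r s <= s)%R by rewrite ge_min lexx orbT.
have [_ [[b _ <-] sb]] := cf _ (hm_nbhs f eE m0).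
have [u uz] := rP _ (small_le mr sb).
have [v vt] := sP _ (small_le ms sb).
rewrite /apart /= fe // => /contrapT Ev.
rewrite /apart /= fd // => /contrapT Eu.
exact: Esep Eu Ev.
Qed.

End HartmanMycielski.

(** * The algebra of step functions *)

Section StepAlgebra.
Variables (R : realType) (E : nat -> topologicalType) (A : topAlg E).
Hypothesis A_cr : completely_regular_space A.

(** [A] with one of the uniformities that induce its topology. *)
Definition unif : uniformType := @completely_regular_uniformity.type R _ A_cr.

Lemma unif_nbhs (a : A) (V : set (A * A)) : @entourage unif V ->
  \forall b \near a, V (a, b).
Proof.
by move=> eV; apply: filterS (@nbhs_entourage unif a V eV) => b /xsectionP.
Qed.

(** Continuity of an operation, with a single entourage for all arguments:
    the filter of the pairs close to [(c, a)] in this sense converges to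
    [(c, a)] coordinatewise. *)
Lemma alg_op_entourage n (c : E n) (a : 'I_n -> A) V : @entourage unif V ->
  exists2 W, @entourage unif W & \forall c' \near c, forall b : 'I_n -> A,
    (forall i, W (a i, b i)) -> V (alg_op A (c, a), alg_op A (c', b)).
Proof.
move=> eV.
pose F : set_system (E n * {ptws 'I_n -> A}) := [set P |
  exists2 W, @entourage unif W & \forall c' \near c, forall b : 'I_n -> A,
    (forall i, W (a i, b i)) -> P (c', b)].
have FF : Filter F.
  split.
  - by exists setT; [exact: filterT | exact: nearW].
  - move=> P Q [W eW cW] [W' eW' cW']; exists (W `&` W'); first exact: filterI.
    apply: filterS2 cW cW' => c' cP cQ b Wb.
    by split; [apply: cP => i; case: (Wb i) | apply: cQ => i; case: (Wb i)].
  - move=> P Q PQ [W eW cW]; exists W => //; apply: filterS cW => c' cP b /cP.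
    exact: PQ.
suff Fca : F --> ((c, a) : E n * {ptws 'I_n -> A}).
  exact: (Fca _ (@alg_op_continuous _ A n (c, a) _ (unif_nbhs _ eV))).
have Ffst : fst @ F --> c.
  by move=> P cP; exists setT; [exact: filterT | apply: filterS cP].
have Fsnd : snd @ F --> (a : {ptws 'I_n -> A}).
  apply/cvg_sup => i P /= [Q [[D oD <-] Da] QP].
  have : @nbhs unif unif (a i) D by apply: open_nbhs_nbhs.
  rewrite -nbhs_entourageE => -[W eW WD]; exists W => //; apply: nearW => c' b Wb.
  by apply: QP; apply: WD; apply/xsectionP.
have -> : F = (fun p : E n * {ptws 'I_n -> A} => (p.1, p.2)) @ F.
  by apply/seteqP; split => P; rewrite /nbhs /=; congr F; apply/funext => -[].
exact: cvg_pair Ffst Fsnd.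
Qed.

(** The pairing of the finite partitions behind the [x i]. *)
Lemma step_fun_joint n (x : 'I_n -> hm R unif) :
  exists (D : finType) (p : half_open_itv R -> D), forall s t, p s = p t ->
    (fun i => sval (x i) s) = (fun i => sval (x i) t).
Proof.
pose D i := projT1 (cid (svalP (x i)).1).
have [p px] : exists p : forall i, half_open_itv R -> D i,
    forall i s t, p i s = p i t -> sval (x i) s = sval (x i) t.
  exists (fun i => projT1 (cid (projT2 (cid (svalP (x i)).1)))) => i.
  exact: projT2 (cid (projT2 (cid (svalP (x i)).1))).
exists {dffun forall i, D i}, (fun t => [ffun i => p i t]) => s t pst.
apply/funext => i; apply: px.
by move/ffunP: pst => /(_ i); rewrite !ffunE.
Qed.

Lemma step_fun_op n (c : E n) (x : 'I_n -> hm R unif) :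
  step_fun (fun t => alg_op A (c, fun i => sval (x i) t)).
Proof.
split.
  have [D [p px]] := step_fun_joint x.
  by exists D, p => s t /px ->.
move=> t.
have /choice[d dP] : forall i, exists d : R, (0 < d)%R /\
    forall u, (sval t <= sval u < sval t + d)%R -> sval (x i) u = sval (x i) t.
  by move=> i; have [_ /(_ t)[d d0 dx]] := svalP (x i); exists d.
exists (\big[Num.min/1%R]_i d i).
  by apply: lt_bigmin => // i _; case: (dP i).
move=> u /andP[tu ud]; congr (alg_op A (c, _)); apply/funext => i.
have [_] := dP i; apply; rewrite tu /= (lt_le_trans ud) // lerD2l.
exact: bigmin_le_cond.
Qed.

Definition hm_op n (p : E n * {ptws 'I_n -> hm R unif}) : hm R unif :=
  exist _ _ (step_fun_op p.1 p.2).

(** The arguments take only finitely many tuples of values, so continuity of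
    the operation of [A] at each of these tuples yields one entourage that
    serves them all; outside the union of finitely many small sets the new
    arguments are that close to the old ones. *)
Lemma hm_op_continuous n : continuous (@hm_op n).
Proof.
move=> p; apply: hm_cvg => V r eV r0.
have [D [q qp]] := step_fun_joint p.2.
pose ctrl d (W : set (A * A)) (c : E n) := forall t, q t = d ->
  forall b : 'I_n -> A, (forall i, W (sval (p.2 i) t, b i)) ->
  V (alg_op A (p.1, fun i => sval (p.2 i) t), alg_op A (c, b)).
have /choice[W WP] : forall d : D, exists W, @entourage unif W /\
    \forall c \near p.1, ctrl d W c.
  move=> d; have [[s qs]|nd] := pselect (exists t, q t = d); last first.
    exists setT; split; first exact: filterT.
    by apply: nearW => c t qt; case: nd; exists t.
  have [W eW cW] := alg_op_entourage p.1 (fun i => sval (p.2 i) s) eV.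
  exists W; split => //; apply: filterS cW => c cW t; rewrite -qs => /qp pts b.
  have ptsi i : sval (p.2 i) t = sval (p.2 i) s by exact: (congr1 (@^~ i) pts).
  by rewrite pts => Wb; apply: cW => i; rewrite -ptsi.
pose W' := [set ab | forall d, W d ab].
have eW' : @entourage unif W'.
  by apply: (@filter_forall _ D W (@entourage unif)) => d; case: (WP d).
have [r' r'0 r'P] := @small_finite_union R 'I_n r r0.
have near_op : \forall c \near p.1, forall d, ctrl d (W d) c.
  by apply: filter_forall => d; case: (WP d).
have near_arg : \forall p' \near p, forall i,
    small r' (apart W' (p.2 i) (p'.2 i)).
  apply: (@filter_forall _ _
    (fun i p' => small r' (apart W' (p.2 i) (p'.2 i))) (nbhs p)).
  move=> i; exact: (@arg_continuous n (E n) (hm R unif) i p _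
    (hm_nbhs (p.2 i) eW' r'0)).
have near_op' : \forall p' \near p, forall d, ctrl d (W d) p'.1.
  exact: cvg_fst near_op.
apply: filterS2 near_op' near_arg => p' op_p' arg_p'.
apply: small_sub (r'P _ arg_p') => t nV; apply: contrapT => nW; apply: nV.
apply: (op_p' (q t) t erefl) => i; apply: contrapT => nWi; apply: nW.
by exists i => /(_ (q t)).
Qed.

Definition hm_alg : topAlg E := TopAlg hm_op_continuous.

End StepAlgebra.

Section StepAlgebraInClass.
Variables (R : realType) (E : nat -> topologicalType) (K : topAlg E -> Prop).
Hypothesis K_complete : complete_quasivariety K.
Variable A : topAlg E.
Hypothesis KA : K A.
Hypothesis A_hausdorff : hausdorff_space A.
Hypothesis A_cr : completely_regular_space A.

Lemma hm_alg_tychonoff : tychonoff_space (hm_alg R A_cr).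
Proof.
split; last exact: uniform_completely_regular.
exact: (@hm_hausdorff R (unif R A_cr) A_hausdorff).
Qed.

Lemma step_fun_subalgebra :
  @subalgebra E (prod_topAlg (fun _ : half_open_itv R => A)) [set f | step_fun f].
Proof.
move=> n c x sx.
exact: (@step_fun_op R E A A_cr n c (fun i => exist _ (x i) (sx i))).
Qed.

(** Algebraically the step functions form a subalgebra of a power of [A];
    only their topology differs from the product topology. *)
Lemma hm_alg_in_class : K (hm_alg R A_cr).
Proof.
have [[Ksub Kprod] Kiso] := K_complete.
apply: (Kiso _ _ hm_alg_tychonoff
  (Ksub _ _ step_fun_subalgebra (Kprod _ _ (fun=> KA)))).
pose to_sub (f : hm R (unif R A_cr)) :
    [set f : half_open_itv R -> A | step_fun f] :=
  exist _ (sval f) (mem_set (svalP f)).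
exists to_sub; split; first by move=> n c x; apply: val_inj.
exists (fun g => exist _ (val g) (set_mem (valP g)) : hm R (unif R A_cr)).
  by move=> f; apply: hm_ext.
by move=> g; apply: val_inj.
Qed.

Lemma hm_const_hom : @alg_hom E A (hm_alg R A_cr) (@hm_const R (unif R A_cr)).
Proof. by move=> n c x; apply: hm_ext. Qed.

End StepAlgebraInClass.

(** * Extension of maps into the space of step functions *)

Section Extension.
Local Open Scope ring_scope.
Variables (R : realType) (X Y : topologicalType) (A : uniformType).
Hypothesis Y_hausdorff : hausdorff_space Y.
Variable S : nat -> set Y -> set Y.
Hypothesis S_strat : open_stratification S.
Variable e : X -> Y.
Hypothesis e_emb : closed_topological_embedding e.
Variable f : X -> A.
Hypothesis f_continuous : continuous f.
Variable a0 : A.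

Local Notation Z := (~` range e).

Lemma open_compl_range : open Z.
Proof. by rewrite openC; case: e_emb. Qed.

(** The union over all levels avoids a choice of one; it is empty unless [y]
    lies in [Z]. *)
Definition star (y : Y) : set Y :=
  \bigcup_(n in [set n | S n Z y]) cell S n Z y.

Lemma open_star y : open (star y).
Proof.
by apply: bigcup_open => n _; exact: (open_cell S_strat n y open_compl_range).
Qed.

Lemma star_center z : Z z -> star z z.
Proof.
move=> Zz; have [n Sz] := cell_exists S_strat open_compl_range Zz.
by exists n => //; exact: cell_center.
Qed.

(** Each [y] outside the range is given the value of [f] at the centre of a
    cell of maximal level containing [y]. Levels are bounded: a cell of
    level at least [n] around a point of the range cannot contain [y] when
    [y] lies in the [n]-th level of the complement. *)
Lemma anchor_exists : exists v : Y -> A, forall y m V x, Z y -> open V ->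
  cell S m V (e x) y -> exists2 x', V (e x') & v y = f x'.
Proof.
suff /choice[v vP] : forall y, exists a : A, forall m V x, Z y -> open V ->
    cell S m V (e x) y -> exists2 x', V (e x') & a = f x'.
  by exists v => y; exact: vP.
move=> y; have [Zy|nZy] := pselect (Z y); last by exists a0.
have oZ := open_compl_range.
pose level m := `[< exists V x, open V /\ cell S m V (e x) y >].
have [[m0 lev0]|nlev] := pselect (exists m, level m); last first.
  exists a0 => m V x _ oV cy; case: nlev; exists m.
  by apply/asboolP; exists V, x.
have [n0 Sy] := cell_exists S_strat oZ Zy.
have lev_le m : level m -> (m <= n0)%N.
  move=> /asboolP[V [x [oV cx]]]; rewrite leqNgt; apply/negP => /ltnW n0m.
  have : Z (e x).
    apply: (cell_meet Y_hausdorff S_strat oZ n0m _ cx).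
    exact: (cell_center Y_hausdorff S_strat Sy).
  by apply; exists x.
have exlev : exists m, level m by exists m0.
case: (ex_maxnP exlev lev_le) => n /asboolP[V [x [oV cx]]] n_max.
exists (f x) => m W x' _ oW cx'; exists x => //.
have mn : (m <= n)%N by apply: n_max; apply/asboolP; exists W, x'.
exact: (cell_meet Y_hausdorff S_strat oW mn cx' cx).
Qed.

(** Let [N] be a cell around [e x] inside a cell [U] around [e x] inside an
    open set [V] chosen for [W]. If [star y] meets [N], then [y] lies in [U],
    as [e x] is not in [Z]; so the anchor of [y] lies in [V]. *)
Lemma anchor_nbhs (v : Y -> A) :
  (forall y m V x, Z y -> open V -> cell S m V (e x) y ->
     exists2 x', V (e x') & v y = f x') ->
  forall x W, nbhs (f x) W -> exists2 N, nbhs (e x) N &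
    (forall x', N (e x') -> W (f x')) /\
    (forall y z, N z -> star y z -> W (v y)).
Proof.
move=> vP x W /f_continuous/(embedding_nbhs e_emb.1)[V [oV Vx VW]].
have oZ := open_compl_range.
have [k Sk] := cell_exists S_strat oV Vx.
have oU := open_cell S_strat k (e x) oV.
have [m Sm] := cell_exists S_strat oU (cell_center Y_hausdorff S_strat Sk).
exists (cell S m (cell S k V (e x)) (e x)).
  apply: open_nbhs_nbhs; split; first exact: (open_cell S_strat).
  exact: (cell_center Y_hausdorff S_strat Sm).
split=> [x' /(cell_sub S_strat oU)/(cell_sub S_strat oV)/VW //|].
move=> y z cz [n Sy yz].
have Zy : Z y.
  apply: (cell_sub S_strat oZ).
  exact: (cell_center Y_hausdorff S_strat Sy).
have [cy|] := cells_meet Y_hausdorff S_strat oU oZ cz yz.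
  by have [x' /VW Wx' ->] := vP _ _ _ _ Zy oV cy.
by case; exists x.
Qed.

Variable P : weighted_refinement R star.

(** [tail n z] is what the first [n.+1] weights leave of the unit interval:
    the [n]-th step occupies the part from [tail n z] to [tail n.-1 z], or to 1
    when [n] is 0. *)
Fixpoint tail n z : R :=
  if n is m.+1 then tail m z * (1 - weight P n z) else 1 - weight P 0 z.

Lemma tail_continuous n : continuous (tail n).
Proof.
elim: n => [|n IH] z /=.
  by apply: cvgB; [exact: cvg_cst | exact: weight_continuous].
apply: cvgM; first exact: IH.
by apply: cvgB; [exact: cvg_cst | exact: weight_continuous].
Qed.

Lemma tail_eq0 z : Z z -> exists n, tail n z = 0.
Proof.
move=> /star_center/(weight_eq1 P)[n wn]; exists n.
by case: n wn => [|n] /= ->; rewrite subrr ?mulr0.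
Qed.

(** The index of the step to which [t] belongs. *)
Definition least_tail z (t : R) n : Prop :=
  tail n z <= t /\ forall m, (m < n)%N -> t < tail m z.

Lemma least_tail_exists z (t : half_open_itv R) :
  Z z -> exists n, least_tail z (sval t) n.
Proof.
move=> /tail_eq0[N TN]; have ex : exists n, tail n z <= sval t.
  by exists N; rewrite TN; case/andP: (svalP t).
exists (ex_minn ex); case: ex_minnP => n Tn nmin; split => // m mn.
by rewrite ltNge; apply/negP => /nmin; rewrite leqNgt mn.
Qed.

Lemma least_tail_le z t n m : least_tail z t n -> tail m z <= t -> (n <= m)%N.
Proof.
move=> [_ nmin] Tm; rewrite leqNgt; apply/negP => /nmin.
by rewrite ltNge Tm.
Qed.

Lemma least_tail_unique z t n m : least_tail z t n -> least_tail z t m -> n = m.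
Proof.
move=> ln lm; apply/eqP; rewrite eqn_leq (least_tail_le ln lm.1).
exact: least_tail_le lm ln.1.
Qed.

Lemma least_tail_weight z (t : half_open_itv R) n : least_tail z (sval t) n ->
  weight P n z <> 0.
Proof.
move=> [+ nmin] w0; have /andP[_ t1] := svalP t.
case: n w0 nmin => [|n] /= -> nmin; rewrite subr0.
  by rewrite leNgt t1.
by rewrite mulr1 leNgt nmin.
Qed.

(** At a point of the range all the values in use nearby are close to the
    prescribed one. At a point [z] of [Z] with [tail N z = 0], the functions
    [g z] and [g w] agree outside small intervals around the [tail n z] with
    [n <= N], once the tails at [w] are close to those at [z] and [w] is in the
    pieces that carry a nonzero weight at [z]. *)
Lemma extension : exists g : Y -> hm R A,
  continuous g /\ forall x, g (e x) = hm_const R (f x).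
Proof.
have [v vP] := anchor_exists.
(* [q n z] is the value on the [n]-th step at [z]. *)
have /choice[q qP] : forall n, exists q : Y -> A,
    forall y z, piece P n y z -> q z = v y.
  move=> n; suff /choice[q qP] : forall z, exists a : A,
      forall y, piece P n y z -> a = v y by exists q => y z; exact: qP.
  move=> z; have [[y Pyz]|nP] := pselect (exists y, piece P n y z).
    by exists (v y) => y' Py'z; rewrite (piece_disjoint Pyz Py'z).
  by exists a0 => y Pyz; case: nP; exists y.
have /choice[g0 g0P] : forall z, exists g : hm R A,
    (forall x, e x = z -> g = hm_const R (f x)) /\
    (Z z -> forall t n, least_tail z (sval t) n -> sval g t = q n z).
  move=> z; have [[x _ <-]|nz] := pselect (range e z).
    exists (hm_const R (f x)); split; last by case; exists x.
    by have [inj_e _ _] := e_emb.1; move=> x' /inj_e ->.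
  have Zz : Z z := nz; have /choice[k kP] := fun t => @least_tail_exists z t Zz.
  have step_q : step_fun (fun t => q (k t) z).
    split.
      have [N TN] := tail_eq0 Zz; exists 'I_N.+1, (fun t => inord (k t)).
      have kN t : (k t < N.+1)%N.
        by apply: least_tail_le (kP t) _; rewrite TN; case/andP: (svalP t).
      by move=> s t /(congr1 val); rewrite /= !inordK // => ->.
    move=> t; exists (\big[Num.min/1]_(m < k t) (tail m z - sval t)).
      apply: lt_bigmin => // m _; rewrite subr_gt0.
      by apply: (kP t).2; exact: ltn_ord.
    move=> u /andP[tu ut]; congr (q _ z); apply: least_tail_unique (kP u) _.
    split; first exact: le_trans (kP t).1 tu.
    move=> m mk; apply: (lt_le_trans ut); rewrite -lerBrDl.
    exact: (bigmin_le _ (Ordinal mk)).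
  exists (exist _ _ step_q); split=> [x xz|_ t n /least_tail_unique tn] /=.
    by case: nz; exists x.
  by rewrite (tn _ (kP t)).
exists g0; split; last by move=> x; apply: (g0P _).1.
move=> z; apply: hm_cvg => E r eE r0; have [[x _ <-]|nz] := pselect (range e z).
  have [N Nx [NX NY]] := anchor_nbhs vP (nbhs_entourage (f x) eE).
  apply: filterS Nx => w Nw; apply: small_sub (small_set0 r0) => t; apply.
  rewrite ((g0P (e x)).1 x erefl) /=.
  have [[x' _ xw]|nw] := pselect (range e w).
    rewrite ((g0P w).1 x' xw) /=; apply/xsectionP/NX; by rewrite xw.
  have [n nt] := @least_tail_exists w t nw.
  rewrite ((g0P w).2 nw t n nt).
  have [y Py] := weight_piece (least_tail_weight nt).
  by rewrite (qP _ _ _ Py); apply/xsectionP/(NY _ _ Nw)/(piece_sub Py).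
have [N TN] := @tail_eq0 z nz.
have [d d0 dP] := @small_finite_union R 'I_N.+1 r r0.
have /choice[c cP] : forall n : 'I_N.+1, exists c : R, 0 < c /\
    small d [set t | `|sval t - tail n z| <= c].
  by move=> n; have [c c0 cs] := small_segment (tail n z) d0; exists c.
have near_tail : \forall w \near z, forall n : 'I_N.+1,
    `|tail n z - tail n w| < c n.
  apply: filter_forall => n; have [cn _] := cP n.
  have /cvgrPdist_lt/(_ _ cn) := @tail_continuous n z; exact.
have near_q : \forall w \near z, forall n : 'I_N.+1,
    weight P n z <> 0 -> q n w = q n z.
  apply: filter_forall => n.
  have [w0|/eqP w0] := eqVneq (weight P n z) 0; first exact: nearW.
  have [y Py] := weight_piece w0.
  have : nbhs z (piece P n y).
    by apply: open_nbhs_nbhs; split => //; exact: open_piece.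
  by apply: filterS => w Pw _; rewrite (qP _ _ _ Pw) (qP _ _ _ Py).
have near_Z : nbhs z Z.
  by apply: open_nbhs_nbhs; split => //; exact: open_compl_range.
apply: filterS3 near_tail near_q near_Z => w Tw qw Zw.
apply: small_sub (dP _ (fun n => (cP n).2)) => t nE; apply: contrapT => nseg.
apply: nE; suff -> : sval (g0 w) t = sval (g0 z) t by exact: entourage_refl.
have Tzw n : (n <= N)%N -> (tail n w <= sval t) = (tail n z <= sval t).
  move=> nN; have := Tw (Ordinal (nN : n < N.+1)%N) => /=; set cn := c _ => Tn.
  have : ~ `|sval t - tail n z| <= cn.
    by move=> nt; apply: nseg; exists (Ordinal (nN : n < N.+1)%N).
  move=> /negP; rewrite -ltNge.
  move: Tn; rewrite ltr_norml ltr_normr => /andP[T1 T2] /orP[] H.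
    by apply/idP/idP => ?; lra.
  by apply/idP/idP => ?; lra.
have [n nt] := @least_tail_exists z t nz.
have nN : (n <= N)%N.
  by apply: least_tail_le nt _; rewrite TN; case/andP: (svalP t).
have nt' : least_tail w (sval t) n.
  split; first by rewrite Tzw //; exact: nt.1.
  move=> m mn; rewrite ltNge Tzw; last exact: leq_trans (ltnW mn) nN.
  by rewrite -ltNge; exact: nt.2.
rewrite ((g0P w).2 Zw t n nt') ((g0P z).2 nz t n nt).
exact: (qw (Ordinal (nN : n < N.+1)%N) (least_tail_weight nt)).
Qed.

End Extension.

(** * Free algebras *)

Theorem theorem1 (E : nat -> topologicalType) (K : topAlg E -> Prop)
    (K_complete : complete_quasivariety K)
    (K_tychonoff : forall A : topAlg E, K A -> tychonoff_space A)
    (X Y : topologicalType)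
    (X_strat : stratifiable_space X) (Y_strat : stratifiable_space Y)
    (e : X -> Y) (e_emb : closed_topological_embedding e)
    (FX FY : topAlg E) (iX : X -> FX) (iY : Y -> FY)
    (FX_free : free_algebra K iX) (FY_free : free_algebra K iY) :
  exists h : FX -> FY,
    unique (induced_hom e iX iY) h /\ closed_topological_embedding h.
Proof.
have [KFX cont_iX FX_univ] := FX_free; have [KFY cont_iY FY_univ] := FY_free.
have [FX_hausdorff FX_cr] := K_tychonoff _ KFX.
have [FY_hausdorff _] := K_tychonoff _ KFY.
have cont_e : continuous e by have [[]] := e_emb.
have cont_iYe : continuous (iY \o e).
  by move=> x; apply: continuous_comp; [exact: cont_e | exact: cont_iY].
have [h [[cont_h hom_h hE] h_uniq]] := FX_univ FY (iY \o e) KFY cont_iYe.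
exists h; split.
  by split=> // h' [cont_h' hom_h' h'E]; apply: h_uniq.
(* The extension uses a default value in [FX]. *)
have [[a0 _]|FX_empty] := pselect (exists a : FX, True); last first.
  split; last first.
    suff -> : range h = set0 by exact: closed0.
    by rewrite -subset0 => y [a _ _]; case: FX_empty; exists a.
  by apply: nbhs_embedding => // a; case: FX_empty; exists a.
pose R : realType := Rdefinitions.R.
have [S S_strat] := stratifiable_open_stratification Y_strat.
have Y_hausdorff : hausdorff_space Y by case: Y_strat.
have [P] := weighted_refinement_exists R Y_hausdorff S_strat
  (open_star S_strat e_emb).
have [g [cont_g ge]] := @extension R X Y (unif R FX_cr) Y_hausdorff S S_strat
  e e_emb iX cont_iX a0 P.
have K_hm := hm_alg_in_class R K_complete KFX FX_hausdorff FX_cr.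
have [ghat [[cont_ghat hom_ghat gE] _]] := FY_univ (hm_alg R FX_cr) g K_hm cont_g.
pose const : FX -> hm_alg R FX_cr := @hm_const R (unif R FX_cr).
have cont_const : continuous const.
  exact: (@hm_const_continuous R (unif R FX_cr)).
(* Both sides are continuous homomorphisms extending [const \o iX]. *)
have ghat_h : ghat \o h = const.
  have [k [_ k_uniq]] := FX_univ (hm_alg R FX_cr) (const \o iX) K_hm
    (fun x => continuous_comp (@cont_iX x) (@cont_const (iX x))).
  rewrite -(k_uniq const); last by split=> //; exact: hm_const_hom.
  apply/esym/k_uniq; split.
  - by move=> x; apply: continuous_comp; [exact: cont_h | exact: cont_ghat].
  - by move=> n c x; rewrite /= -hom_h -hom_ghat.
  - apply/funext => x /=; rewrite -[h (iX x)]/((h \o iX) x) -hE.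
    by rewrite -[RHS]/((ghat \o iY) (e x)) -gE ge.
apply: (closed_embedding_factor FY_hausdorff cont_h cont_ghat).
rewrite ghat_h; split; first exact: hm_const_embedding.
exact: (@hm_const_closed R (unif R FX_cr) FX_hausdorff).
Qed.
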